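(* Let $R$ be a graded $\mathbb Z[1/2]$-algebra and $\mu_0(x,y)$ a formal group law over $R$. If $(\iota,\Psi,F_t)=\mathbb T(\mu_0)$, then $\mathbb G(\iota,\Psi,F_t)=\mu_0$.
   Context: Graded rings are commutative; formal group laws $\mu(x,y)$ over graded rings are homogeneous with $|x|=|y|=-2$. Over a graded $\mathbb Z[1/2]$-algebra $R$: Framed involution. A framed involution $(\iota,\Psi)$ over $R$ is a power series $\Psi(t)=t+O(t^2)\in R[[t]]$, $|t|=-2$, homogeneous of degree $-2$, with $\iota(t):=t-2\Psi(t)$ satisfying $\iota(\iota(t))=t$. (Over general graded rings one imposes a ''$2$-saturated'' version of this equation and of the axioms below; over $\mathbb Z[1/2]$-algebras this is the same.) Series. An $(m,n)$-series over $R$ is an element $G_t=1+\sum_{l=1}^mG_l(x_1,\dots,x_n)t^l$ of $R[[x_1,\dots,x_n]][t]$ homogeneous of degree $0$, where $|x_i|=-2$, $|t|=2$. When $G_t(0,\dots,0)=1$, write $G_t=\prod_i(1+r_it)$ in a splitting algebra. Substitution is rootwise: $F_t(G_t,u,v):=\prod_iF_t(r_i,u,v)$. For $\Phi(x)=x+O(x^2)$ homogeneous of degree $-2$, the transport is $(\Phi_*G)_t=\prod_i\bigl(1+\Phi(r_i(\Phi^{-1}(x_1),\dots,\Phi^{-1}(x_n)))t\bigr)$. Formal ternary law. A formal ternary law (FTL) over $R$ with framed involution $(\iota,\Psi)$ is a $(4,3)$-series $F_t(x,y,z)=1+\sum_{l=1}^4F_lt^l$ over $R$ such that: (1) $F_t(x,0,0)=(1+xt)^2(1+\iota(x)t)^2$;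 (2) $F_t$ is symmetric in $x,y,z$; (3) $F_t(F_t(x,y,z),u,v)=F_t(x,F_t(y,z,u),v)$; (4) $\widehat F_t:=\Psi_*F_t$ satisfies $\widehat F_t(-x,y,z)=\widehat F_{-t}(x,y,z)$; (5) $F_t(x,x,y)=(1+yt)^2(1+S(x,y)t+P(x,y)t^2)$ for some $S,P\in R[[x,y]]$. $\mathbb T$. For a formal group law $\mu$ with formal inverse $\iota$ (write $x^{1}=x$, $x^{-1}=\iota(x)$), $\mathbb T(\mu)=(\iota,\Psi,F_t)$ with $\Psi(x)=(x-\iota(x))/2$ and $F_t(x,y,z)=\prod_{\varepsilon_i\in\{\pm1\},\,\varepsilon_1\varepsilon_2\varepsilon_3=-1}(1+\mu(\mu(x^{\varepsilon_1},y^{\varepsilon_2}),z^{\varepsilon_3})t)$; it is an FTL. $\mathbb G$. For an FTL $(\iota,\Psi,F_t)$: $S=F_1(x,x,y)-2y$ and $P=F_2(x,x,y)-2yS-y^2$. The series $D:=S^2-4P$ is divisible by $x^2$ and $\equiv16x^2$ mod $(x,y)^3$, so it has a unique square root $\sqrt D=4x\sqrt{D/(16x^2)}\equiv4x$ mod $(x,y)^2$ (binomial series). Put $B(x,y):=\tfrac12(S-\sqrt D)$; $f(x,y):=B(\iota(x),\iota(y))$; $[2](x):=f(x,0)\equiv2x$ mod $x^2$; $[1/2](x)$ is the compositional inverse of $[2](x)$. Then $\mathbb G(\iota,\Psi,F_t)$ is the formal group law $f([1/2](x),y)$. *)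

(* Defs.v *)
From HB Require Import structures.
From mathcomp Require Import all_boot all_order all_algebra.
From mathcomp Require Import boolp.
From mathcomp Require classical_sets.
From mathcomp Require Import ssrcomplements mpoly.
From mathcomp Require Import ring zify.

Set Implicit Arguments.
Unset Strict Implicit.
Unset Printing Implicit Defensive.

Import GRing.Theory.
Local Open Scope ring_scope.

Record fps (n : nat) (R : Type) := FPS { fps_coef :> 'X_{1..n} -> R }.

Notation "{ 'fps' R [ n ] }" := (fps n R)
  (at level 0, R, n at level 2, format "{ 'fps'  R [ n ] }") : type_scope.

HB.instance Definition _ n (R : Type) := gen_eqMixin {fps R[n]}.
HB.instance Definition _ n (R : Type) := gen_choiceMixin {fps R[n]}.

Lemma fpsP n (R : Type) (f g : {fps R[n]}) : f =1 g -> f = g.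
Proof. by case: f => f; case: g => g /= /funext ->. Qed.

Section FpsRing.
Context (n : nat) (R : comPzRingType).
Implicit Types (f g h : {fps R[n]}) (m : 'X_{1..n}).

Definition fps_zero : {fps R[n]} := FPS (fun=> 0).
Definition fps_opp f : {fps R[n]} := FPS (fun m => - f m).
Definition fps_add f g : {fps R[n]} := FPS (fun m => f m + g m).

Definition fpsC (c : R) : {fps R[n]} :=
  FPS (fun m => if m == 0%MM then c else 0).

(* The degree bound on [k] is implied by [k <= m]; it makes the sum finite. *)
Definition fps_mul f g : {fps R[n]} :=
  FPS (fun m => \sum_(k : 'X_{1..n < (mdeg m).+1} | (k <= m)%MM)
                  f k * g (m - k)%MM).

Lemma fps_addA : associative fps_add.
Proof. by move=> f g h; apply: fpsP => m /=; rewrite addrA. Qed.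
Lemma fps_addC : commutative fps_add.
Proof. by move=> f g; apply: fpsP => m /=; rewrite addrC. Qed.
Lemma fps_add0 : left_id fps_zero fps_add.
Proof. by move=> f; apply: fpsP => m /=; rewrite add0r. Qed.
Lemma fps_addN : left_inverse fps_zero fps_opp fps_add.
Proof. by move=> f; apply: fpsP => m /=; rewrite addNr. Qed.

HB.instance Definition _ := GRing.isZmodule.Build {fps R[n]}
  fps_addA fps_addC fps_add0 fps_addN.

Lemma fps_mulwE f g m b : (mdeg m < b)%N ->
  fps_mul f g m = \sum_(k : 'X_{1..n < b} | (k <= m)%MM) f k * g (m - k)%MM.
Proof.
move=> lt_mb /=.
pose I1 : subFinType _ := 'X_{1..n < (mdeg m).+1}.
pose I2 : subFinType _ := 'X_{1..n < b}.
rewrite (big_sub_widen I1 I2 (fun k => (k <= m)%MM)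
  (fun k => f k * g (m - k)%MM)) /=; last by move=> k /leq_trans; apply.
apply: eq_bigl => k /=; case: (boolP (k <= m)%MM) => //= le_km.
by rewrite ltnS -[in X in (_ <= X)%N](submK le_km) mdegD leq_addl.
Qed.

Lemma fps_mulC : commutative fps_mul.
Proof.
move=> f g; apply: fpsP => m /=.
have pr (h : 'X_{1..n}) : (mdeg (m - h)%MM < (mdeg m).+1)%N.
  by rewrite ltnS mdegB.
pose F (k : 'X_{1..n < (mdeg m).+1}) := BMultinom (pr k).
have inv_F (h : 'X_{1..n}) : (h <= m)%MM -> (m - (m - h))%MM = h.
  by move=> le_hm; rewrite submBA // addmC addmK.
rewrite (reindex_onto F F) //=; last first.
  by move=> h /inv_F eqh; apply/eqP; rewrite eqE /= eqh.
apply/esym/eq_big => [h /=|h /inv_F ->]; last by rewrite mulrC.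
apply/esym; rewrite lem_subr eqE /=.
by apply/eqP/idP => [<-|/inv_F //]; apply/mnm_lepP=> i; rewrite !mnmBE leq_subr.
Qed.

Lemma fps_mulA : associative fps_mul.
Proof.
move=> p q r; apply: fpsP => mi; set b := (mdeg mi).+1.
have hb : (mdeg mi < b)%N by [].
have h m : (mdeg (mi - m)%MM < b)%N by exact: (leq_ltn_trans (mdegB mi m)).
have mulr_wE f g m : (mdeg m < b)%N ->
  fps_mul f g m = \sum_(k : 'X_{1..n < b} | (k <= m)%MM) f (m - k)%MM * g k.
  by move=> lt; rewrite fps_mulC (fps_mulwE _ _ lt); apply: eq_bigr => k _;
     rewrite mulrC.
rewrite (fps_mulwE _ _ hb) (mulr_wE _ _ _ hb).
pose coef3 mj mk := p mj * (q (mi - mj - mk)%MM * r mk).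
transitivity (\sum_(mj : 'X_{1..n < b} | (mj <= mi)%MM)
                \sum_(mk : 'X_{1..n < b} | (mk <= mi - mj)%MM)
                   coef3 mj mk).
  by apply/eq_bigr=> mj _; rewrite (mulr_wE _ _ _ (h mj)) big_distrr.
pose P (mj : 'X_{1..n < b}) := (mj <= mi)%MM.
rewrite (exchange_big_dep P) //= {}/P; last first.
  by move=> mj mk _ /lepm_trans; apply; apply/lem_subr.
apply/eq_bigr=> mk /mnm_lepP le_mk_mi.
transitivity (\sum_(mj : 'X_{1..n < b} | (mj <= mi - mk)%MM) coef3 mj mk).
+ apply/eq_bigl=> m /=.
  apply/idP/idP => [/andP[/mnm_lepP le1 /mnm_lepP le2]|le1].
  * apply/mnm_lepP => i; rewrite mnmBE /leq subnBA // addnC -subnBA //.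
    by rewrite -mnmBE; apply/le2.
  * have le2: (m <= mi)%MM by rewrite (lepm_trans le1) ?lem_subr.
    rewrite le2; apply/mnm_lepP=> i; rewrite mnmBE /leq.
    move/mnm_lepP: le2 => le2; rewrite subnBA // addnC.
    by rewrite -subnBA //; move/mnm_lepP/(_ i): le1; rewrite mnmBE.
have /= -> := fps_mulwE p q (h mk); rewrite /coef3 big_distrl /=.
by apply/eq_bigr=> mj le_mj_miBk; rewrite !mulrA !submDA addmC.
Qed.

Lemma fps_mul1 : left_id (fpsC 1) fps_mul.
Proof.
move=> f; apply: fpsP => m /=.
have b0 : (mdeg (0%MM : 'X_{1..n}) < (mdeg m).+1)%N by rewrite mdeg0.
rewrite (bigD1 (BMultinom b0)) /=; last by apply/mnm_lepP=> i; rewrite mnm0E.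
rewrite eqxx mul1r big1 ?addr0; last first.
  by move=> k /andP[_ /negPf]; rewrite bmeqP /= => ->; rewrite mul0r.
by congr (f _); apply/mnmP => i; rewrite mnmBE mnm0E subn0.
Qed.

Lemma fps_mulDl : left_distributive fps_mul fps_add.
Proof.
move=> f g h; apply: fpsP => m /=; rewrite -big_split.
by apply: eq_bigr => k _; rewrite mulrDl.
Qed.

HB.instance Definition _ := GRing.Zmodule_isComPzRing.Build {fps R[n]}
  fps_mulA fps_mulC fps_mul1 fps_mulDl.

Definition fpsX (i : 'I_n) : {fps R[n]} :=
  FPS (fun m => if m == U_(i)%MM then 1 else 0).

(* Exact quotient by ['X_i ^+ k] when [f] is divisible by it. *)
Definition fps_divX (i : 'I_n) (k : nat) f : {fps R[n]} :=
  FPS (fun m => f (m + U_(i) *+ k)%MM).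

End FpsRing.

(* Substitution [f(g_1, .., g_n)], meaningful only when every [g_i] has zero
   constant coefficient: monomials of degree larger than [mdeg m] then do not
   contribute to the coefficient of [m]. *)
Definition fps_comp n k (R : comPzRingType) (f : {fps R[n]})
    (g : n.-tuple {fps R[k]}) : {fps R[k]} :=
  FPS (fun m => \sum_(a : 'X_{1..n < (mdeg m).+1})
         f a * (\prod_(i < n) tnth g i ^+ a i) m).

Notation "f \fPo g" := (fps_comp f g) (at level 50) : ring_scope.

Section Variables.
Context {R : comPzRingType}.
Definition X1 : {fps R[1]} := fpsX R (@Ordinal 1 0 isT).
Definition X2 : {fps R[2]} := fpsX R (@Ordinal 2 0 isT).
Definition Y2 : {fps R[2]} := fpsX R (@Ordinal 2 1 isT).
Definition X3 : {fps R[3]} := fpsX R (@Ordinal 3 0 isT).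
Definition Y3 : {fps R[3]} := fpsX R (@Ordinal 3 1 isT).
Definition Z3 : {fps R[3]} := fpsX R (@Ordinal 3 2 isT).
End Variables.

Record grading (R : comPzRingType) := Grading {
  in_degree : int -> R -> Prop;
  in_degree0 : forall d, in_degree d 0;
  in_degreeB : forall d a b, in_degree d a -> in_degree d b -> in_degree d (a - b);
  in_degree1 : in_degree 0 1;
  in_degreeM : forall d e a b, in_degree d a -> in_degree e b -> in_degree (d + e) (a * b);
  grading_decomp : forall a, exists (s : seq int) (c : int -> R),
    (forall d, in_degree d (c d)) /\ a = \sum_(d <- s) c d;
  grading_direct : forall (s : seq int) (c : int -> R), uniq s ->
    (forall d, in_degree d (c d)) -> \sum_(d <- s) c d = 0 ->
    forall d, d \in s -> c d = 0
}.

(* Every variable has degree -2, so the coefficient of a monomial [m] in a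
   series of degree [d] has degree [d + 2 * mdeg m]. *)
Definition fps_homog (R : comPzRingType) (gr : grading R) n (d : int)
    (f : {fps R[n]}) : Prop :=
  forall m, in_degree gr (d + 2 * (mdeg m)%:Z) (f m).

Record fgl (R : comPzRingType) (gr : grading R) := FGL {
  fgl_series :> {fps R[2]};
  fgl_homog : fps_homog gr (- 2) fgl_series;
  fgl_x0 : fgl_series \fPo [tuple X1; 0] = X1;
  fgl_0y : fgl_series \fPo [tuple 0; X1] = X1;
  fgl_comm : fgl_series \fPo [tuple Y2; X2] = fgl_series;
  fgl_assoc :
    fgl_series \fPo [tuple fgl_series \fPo [tuple X3; Y3]; Z3] =
    fgl_series \fPo [tuple X3; fgl_series \fPo [tuple Y3; Z3]]
}.

(* The series [i] without constant term such that [mu(x, i(x)) = 0]. *)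
Definition formal_inverse (R : comPzRingType) (mu : {fps R[2]}) : {fps R[1]} :=
  classical_sets.xget 0 (fun i : {fps R[1]} =>
    i 0%MM = 0 /\ mu \fPo [tuple X1; i] = 0).

Definition compositional_inverse (R : comPzRingType) (g : {fps R[1]}) :
    {fps R[1]} :=
  classical_sets.xget 0 (fun h : {fps R[1]} =>
    [/\ h 0%MM = 0, g \fPo [tuple h] = X1 & h \fPo [tuple g] = X1]).

(* For [k > 0], [binom(1/2, k) = (-1)^(k-1) * 2 * Cat_(k-1) / 4^k], where
   [Cat_j = binom(2j, j) / (j+1)] is a Catalan number; this is an element of
   Z[1/2], here mapped to [R] (see [half_binomialE]). *)
Definition half_binomial (R : comPzRingType) (half : R) (k : nat) : R :=
  if k is j.+1 then
    (-1) ^+ j * ('C(j.*2, j) %/ j.+1)%:R *+ 2 * half ^+ k.*2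
  else 1.

Lemma catalan_dvd j : (j.+1 * ('C(j.*2, j) %/ j.+1) = 'C(j.*2, j))%N.
Proof.
rewrite mulnC divnK //; apply/dvdnP; exists ('C(j.*2, j) - 'C(j.*2, j.+1))%N.
rewrite mulnBl [X in (_ - X)%N]mulnC mul_bin_left -addnn addnK.
by rewrite mulnS mulnC addnK.
Qed.

Lemma catalanS j : (j.+2 * ('C(j.+1.*2, j.+1) %/ j.+2) =
  (j.*2.+1).*2 * ('C(j.*2, j) %/ j.+1))%N.
Proof.
have := mul_bin_diag j.*2.+2 j; have := mul_bin_left j.*2.+1 j.
have := mul_bin_diag j.*2.+1 j.
have := catalan_dvd j; have := catalan_dvd j.+1; rewrite doubleS /=.
have := mul_bin_down j.*2.+1 j => /=.
set A := (_ %/ j.+2)%N; set B := (_ %/ j.+1)%N.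
have -> : (j.*2.+1 - j = j.+1)%N by lia.
move=> e1 e2 e3 e4 e5 e6.
apply/eqP; rewrite -(eqn_pmul2l (ltn0Sn j)); apply/eqP.
have : (j.+1 * (j.+2 * A) = 2 * (j.+1 * 'C(j.*2.+1, j)))%N by rewrite e2 -e6; lia.
by rewrite -e1 -e3 => ->; lia.
Qed.

Lemma half_binomialE (R : comPzRingType) (half : R) k : 2 * half = 1 ->
  half_binomial half k * k`!%:R = \prod_(j < k) (half - j%:R).
Proof.
move=> h2; elim: k => [|[|j] IH]; first by rewrite big_ord0 mulr1.
  rewrite big_ord1 /half_binomial /= bin0 divn1 subr0 (_ : 1`! = 1)%N //.
  transitivity (2 * half * half); first by ring.
  by rewrite h2 mul1r.
rewrite big_ord_recr /= -IH factS natrM /half_binomial !doubleS.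
have e := congr1 (fun n : nat => n%:R : R) (catalanS j).
rewrite !natrM in e.
set a := (_ %/ j.+2)%:R in e *; set b := (_ %/ j.+1)%:R in e *.
rewrite [in RHS](_ : half - _ = - half * j.*2.+1%:R); last first.
  transitivity (half - (2 * half) * j%:R - (2 * half)); first by rewrite h2; ring.
  by rewrite -muln2; ring.
rewrite !exprS; set p := half ^+ j.*2; set q := (-1) ^+ j.
transitivity (- (q * 2 * (half * (half * p)) * (j.+1)`!%:R *
                 half * half * (j.+2%:R * a))).
  ring.
rewrite e -[in (j.*2.+1).*2]muln2 natrM.
transitivity (- (q * 2 * (half * (half * p)) * (j.+1)`!%:R *
                 half * (2 * half) * j.*2.+1%:R * b)); first by ring.
by rewrite h2; ring.
Qed.

(* [sqrt(u) = \sum_k binom(1/2, k) (u - 1)^k], for [u] with constant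
   coefficient 1, where [half] is the inverse of 2. *)
Definition fps_sqrt (R : comPzRingType) (half : R) n (u : {fps R[n]}) :
    {fps R[n]} :=
  FPS (fun m : 'X_{1..1} => half_binomial half (mdeg m)) \fPo [tuple u - 1].

(* The underlying data [(iota, Psi, F_t)] of a formal ternary law; [F_t] is a
   series in [t] with coefficients in [R[[x, y, z]]]. *)
Record ternary_data (R : comPzRingType) := TernaryData {
  involution : {fps R[1]};
  framing : {fps R[1]};
  ternary_law : {fps {fps R[3]}[1]}
}.

Definition ternary_coef (R : comPzRingType) (F : {fps {fps R[3]}[1]})
    (l : nat) : {fps R[3]} :=
  F (U_(ord0) *+ l)%MM.

Section Functors.
(* [half] is the inverse of 2 in [R]. *)
Context (R : comPzRingType) (half : R).

(* Signs are encoded by booleans, [true] standing for [-1]. *)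
Definition sign_power (iota : {fps R[1]}) n (u : {fps R[n]}) (e : bool) :
    {fps R[n]} :=
  if e then iota \fPo [tuple u] else u.

Definition bbT (gr : grading R) (mu : fgl gr) : ternary_data R :=
  let iota := formal_inverse mu in
  let root (e : bool * bool * bool) :=
    mu \fPo [tuple mu \fPo [tuple sign_power iota X3 e.1.1;
                                  sign_power iota Y3 e.1.2];
                   sign_power iota Z3 e.2] in
  TernaryData iota (fpsC _ half * (X1 - iota))
    (\prod_(e : bool * bool * bool | e.1.1 (+) e.1.2 (+) e.2)
       (1 + fpsC _ (root e) * X1)).

Section G.
Variable X : ternary_data R.

Let F l := ternary_coef (ternary_law X) l.
Let iota := involution X.

Definition G_S : {fps R[2]} := F 1 \fPo [tuple X2; X2; Y2] - 2 * Y2.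
Definition G_P : {fps R[2]} :=
  F 2 \fPo [tuple X2; X2; Y2] - 2 * Y2 * G_S - Y2 ^+ 2.
Definition G_D : {fps R[2]} := G_S ^+ 2 - 4 * G_P.

Definition G_sqrtD : {fps R[2]} :=
  4 * X2 * fps_sqrt half (fpsC _ half ^+ 4 * fps_divX ord0 2 G_D).

Definition G_B : {fps R[2]} := fpsC _ half * (G_S - G_sqrtD).
Definition G_f : {fps R[2]} :=
  G_B \fPo [tuple iota \fPo [tuple X2]; iota \fPo [tuple Y2]].
Definition G_double : {fps R[1]} := G_f \fPo [tuple X1; 0].
Definition G_halve : {fps R[1]} := compositional_inverse G_double.

Definition bbG : {fps R[2]} := G_f \fPo [tuple G_halve \fPo [tuple X2]; Y2].

End G.
End Functors.

(* Main.v *)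
(* Write [+] and [-] for the formal group operations. On the diagonal the four
   roots of the ternary law become y, y, a = 2x - y and b = -2x - y, hence
   S = a + b, P = ab and D = (a - b)^2. As a - b is divisible by x with leading
   term 4x, and a series with constant term 1 is the only such square root of
   its square (2 being invertible), sqrt D = a - b and B = b. Replacing x, y by
   their inverses gives f = 2x + y, so [2](x) = x + x and f([1/2](x), y) = x + y.

   Identities of substitutions are additive and continuous in the outer series,
   hence need only be checked on monomials; the formal and compositional inverses
   exist by a contraction argument for the adic topology. *)
Require Import Defs.
From mathcomp Require Import all_boot all_order all_algebra.
From mathcomp Require classical_sets.
From mathcomp Require Import ssrcomplements mpoly.
From mathcomp Require Import ring zify.

Set Implicit Arguments.
Unset Strict Implicit.
Unset Printing Implicit Defensive.

Import GRing.Theory Num.Theory.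
Local Open Scope ring_scope.

(** * Coefficients, order of vanishing and truncation of power series *)

Section FpsTheory.
Context (n : nat) (R : comPzRingType).
Implicit Types (f g h : {fps R[n]}) (m a : 'X_{1..n}) (c : R).

Lemma fpsDE f g m : (f + g) m = f m + g m. Proof. by []. Qed.
Lemma fpsNE f m : (- f) m = - f m. Proof. by []. Qed.
Lemma fpsBE f g m : (f - g) m = f m - g m. Proof. by []. Qed.
Lemma fpsCE c m : fpsC n c m = if m == 0%MM then c else 0. Proof. by []. Qed.
Lemma fps1E : 1 = fpsC n (1 : R). Proof. by []. Qed.

Lemma fps_sumE (I : Type) (r : seq I) (P : pred I) (F : I -> {fps R[n]}) m :
  (\sum_(i <- r | P i) F i) m = \sum_(i <- r | P i) F i m.
Proof. exact: (big_morph (fun f : {fps R[n]} => f m)). Qed.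

(** Up to conversion, constants are the case [a = 0] and variables the case [c = 1], [a = U_(i)], so
    facts about monomials apply to both directly. *)
Definition fps_mon c a : {fps R[n]} := FPS (fun m => if m == a then c else 0).

Lemma fps_mon_mulE c a f m :
  (fps_mon c a * f) m = if (a <= m)%MM then c * f (m - a)%MM else 0.
Proof.
case: ifPn => [le_am|nle_am]; last first.
  rewrite [LHS]big1 // => k le_km /=.
  by case: eqP => [eq_ka|]; rewrite ?mul0r //; rewrite -eq_ka le_km in nle_am.
have lt_am : (mdeg a < (mdeg m).+1)%N.
  by rewrite ltnS -[in leqRHS](submK le_am) mdegD leq_addl.
rewrite [LHS](bigD1 (BMultinom lt_am)) //= eqxx big1 ?addr0 // => k /andP[_].
by rewrite bmeqP /= => /negPf ->; rewrite mul0r.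
Qed.

Lemma fpsC_mulE c f m : (fpsC n c * f) m = c * f m.
Proof.
rewrite (fps_mon_mulE c 0) ifT; last by apply/mnm_lepP=> i; rewrite mnm0E.
by congr (_ * f _); apply/mnmP => i; rewrite mnmBE mnm0E subn0.
Qed.

Lemma fpsX_mulE i f m :
  (fpsX R i * f) m = if (U_(i) <= m)%MM then f (m - U_(i))%MM else 0.
Proof. by rewrite (fps_mon_mulE 1 U_(i)) mul1r. Qed.

Lemma fps_monM c1 c2 a1 a2 :
  fps_mon c1 a1 * fps_mon c2 a2 = fps_mon (c1 * c2) (a1 + a2).
Proof.
apply: fpsP => m; rewrite fps_mon_mulE /=.
case: ifPn => [le_am|nle_am].
  have -> : ((m - a1)%MM == a2) = (m == (a1 + a2)%MM).
    by apply/eqP/eqP => [<-|->]; rewrite addmC ?submK ?addmK.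
  by case: ifP; rewrite ?mulr0.
case: eqP => // eq_m; case/negP: nle_am.
by apply/mnm_lepP => i; rewrite eq_m mnmDE leq_addr.
Qed.

Lemma fpsCM c1 c2 : fpsC n (c1 * c2) = fpsC n c1 * fpsC n c2.
Proof. by rewrite (fps_monM c1 c2 0 0) addm0. Qed.

Lemma fpsCD c1 c2 : fpsC n (c1 + c2) = fpsC n c1 + fpsC n c2.
Proof. by apply: fpsP => m /=; case: ifP; rewrite ?addr0. Qed.

(** Membership in the [d]-th power of the ideal generated by the variables, a basic neighbourhood of
    zero in the adic topology. The series 0 has every order. *)
Definition fps_ord d f := forall m, (mdeg m < d)%N -> f m = 0.

Lemma fps_ord1 f : f 0%MM = 0 <-> fps_ord 1 f.
Proof.
split=> [f0 m|]; last by apply; rewrite mdeg0.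
by rewrite ltnS leqn0 mdeg_eq0 => /eqP ->.
Qed.

Lemma fps_ord0 d : fps_ord d 0. Proof. by []. Qed.

Lemma fps_ordD d f g : fps_ord d f -> fps_ord d g -> fps_ord d (f + g).
Proof. by move=> of_ og m lt_md; rewrite fpsDE of_ // og // addr0. Qed.

Lemma fps_ordN d f : fps_ord d f -> fps_ord d (- f).
Proof. by move=> of_ m lt_md; rewrite fpsNE of_ // oppr0. Qed.

Lemma fps_ordB d f g : fps_ord d f -> fps_ord d g -> fps_ord d (f - g).
Proof. by move=> of_ og; apply: fps_ordD => //; apply: fps_ordN. Qed.

Lemma fps_ordW d e f : (d <= e)%N -> fps_ord e f -> fps_ord d f.
Proof. by move=> le_de of_ m lt_md; apply/of_/(leq_trans lt_md). Qed.

Lemma fps_ordM d e f g : fps_ord d f -> fps_ord e g -> fps_ord (d + e) (f * g).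
Proof.
move=> of_ og m lt_m; apply: big1 => k le_km.
have [lt_kd|le_dk] := ltnP (mdeg (k : 'X_{1..n})) d; first by rewrite of_ ?mul0r.
rewrite [g _]og ?mulr0 //.
by have := congr1 (@mdeg n) (submK le_km); rewrite mdegD; lia.
Qed.

Lemma fps_ordMl d f g : fps_ord d g -> fps_ord d (f * g).
Proof. by apply: fps_ordM (0%N) _ _ _ _. Qed.

Lemma fps_ordMr d f g : fps_ord d f -> fps_ord d (f * g).
Proof. by rewrite mulrC; apply: fps_ordMl. Qed.

Lemma fps_ordX d f k : fps_ord d f -> fps_ord (k * d) (f ^+ k).
Proof.
move=> of_; elim: k => [|k IH] //.
by rewrite exprS mulSn; apply: fps_ordM.
Qed.

Lemma fps_ord_eq0 f : (forall d, fps_ord d f) -> f = 0.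
Proof. by move=> of_; apply: fpsP => m; apply: of_ (ltnSn _). Qed.

Lemma fpsX_ord1 i : fps_ord 1 (fpsX R i).
Proof.
apply/fps_ord1 => /=; case: eqP => // /(congr1 (@mdeg n)).
by rewrite mdeg0 mdeg1.
Qed.

Lemma fps0M f g : (f * g) 0%MM = f 0%MM * g 0%MM.
Proof.
have -> : f * g = fpsC n (f 0%MM) * g + (f - fpsC n (f 0%MM)) * g by ring.
rewrite fpsDE fpsC_mulE [X in _ + X](_ : _ = 0) ?addr0 //.
apply/fps_ord1/fps_ordMr/fps_ord1.
by rewrite fpsBE fpsCE eqxx subrr.
Qed.

Lemma fps_trunc_ord d f :
  fps_ord d (f - \sum_(a : 'X_{1..n < d}) fps_mon (f a) a).
Proof.
move=> m lt_md; rewrite fpsBE fps_sumE (bigD1 (BMultinom lt_md)) //= eqxx.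
rewrite big1 ?addr0 ?subrr // => a.
by rewrite bmeqP /= eq_sym => /negPf ->.
Qed.

(* Multiplication by [g] scales the terms of lowest degree of [f] by the unit
   [g 0]. *)
Lemma fps_mul_eq0 f g c : g 0%MM * c = 1 -> f * g = 0 -> f = 0.
Proof.
move=> gc fg0; apply: fps_ord_eq0; elim=> [|d of_] //.
have -> : f = - (f * (g - fpsC n (g 0%MM)) * fpsC n c).
  have e : fpsC n (g 0%MM) * fpsC n c = 1 by rewrite -fpsCM gc.
  have -> : f * (g - fpsC n (g 0%MM)) * fpsC n c =
    f * g * fpsC n c - f * (fpsC n (g 0%MM) * fpsC n c) by ring.
  by rewrite fg0 e mul0r mulr1 sub0r; apply/esym/opprK.
apply/fps_ordN/fps_ordMr; rewrite -addn1; apply: fps_ordM => //.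
by apply/fps_ord1; rewrite fpsBE fpsCE eqxx subrr.
Qed.

End FpsTheory.

(** * Substitution *)

Section Extension.
Context (R : comPzRingType).

(** Additivity, packed into one identity, and continuity in the strong form that orders never
    drop. *)
Definition fps_cont n k (L : {fps R[n]} -> {fps R[k]}) :=
  {morph L : f g / f - g} /\ forall d f, fps_ord d f -> fps_ord d (L f).

Lemma fps_cont0 n k (L : {fps R[n]} -> {fps R[k]}) : fps_cont L -> L 0 = 0.
Proof. by case=> LB _; rewrite -[X in L X](subrr 0) LB subrr. Qed.

Lemma fps_contN n k (L : {fps R[n]} -> {fps R[k]}) f :
  fps_cont L -> L (- f) = - L f.
Proof. by move=> cL; rewrite -sub0r (proj1 cL) fps_cont0 // sub0r. Qed.

Lemma fps_contD n k (L : {fps R[n]} -> {fps R[k]}) f g :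
  fps_cont L -> L (f + g) = L f + L g.
Proof.
move=> cL; have e : f + g = f - - g by ring.
by rewrite e (proj1 cL) (fps_contN _ cL); ring.
Qed.

Lemma fps_cont_id n : fps_cont (@id {fps R[n]}). Proof. by split. Qed.

Lemma fps_cont_comp n k l (L : {fps R[k]} -> {fps R[l]})
    (M : {fps R[n]} -> {fps R[k]}) :
  fps_cont L -> fps_cont M -> fps_cont (fun f => L (M f)).
Proof.
by move=> [LB oL] [MB oM]; split=> [f g|d f /oM /oL //]; rewrite MB LB.
Qed.

Lemma fps_cont_mulr n k (L : {fps R[n]} -> {fps R[k]}) h :
  fps_cont L -> fps_cont (fun f => L f * h).
Proof.
by move=> [LB oL]; split=> [f g|d f /oL /fps_ordMr //]; rewrite LB mulrBl.
Qed.

(** Both maps agree on the polynomial truncation of [f] below degree [d] and send the remainder to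
    order [d], so [L f - M f] has every order. *)
Lemma fps_cont_ext n k (L M : {fps R[n]} -> {fps R[k]}) :
  fps_cont L -> fps_cont M ->
  (forall c a, L (fps_mon c a) = M (fps_mon c a)) -> L =1 M.
Proof.
move=> cL cM eqLM f; apply/eqP; rewrite -subr_eq0; apply/eqP.
apply: fps_ord_eq0 => d.
have tr := @fps_trunc_ord n R d f; set t := \sum_a _ in tr.
have eq_t : L t = M t.
  rewrite /t; apply: (big_ind (fun u => L u = M u)) => //.
    by rewrite !fps_cont0.
  by move=> u v eu ev; rewrite !fps_contD // eu ev.
have -> : L f - M f = L (f - t) - M (f - t).
  by rewrite (proj1 cL) (proj1 cM) eq_t; ring.
by apply: fps_ordB; [apply: (proj2 cL)|apply: (proj2 cM)].
Qed.

End Extension.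

Section Composition.
Context (R : comPzRingType).

(** The sum defining the coefficient of [m] runs over exponents of degree at most [mdeg m], so terms
    of [f] of degree at least [d] never reach lower coefficients. *)
Lemma fps_cont_fcomp n k (g : n.-tuple {fps R[k]}) :
  fps_cont (fun f : {fps R[n]} => f \fPo g).
Proof.
split=> [f1 f2|d f of_ m lt_md].
  apply: fpsP => m; rewrite fpsBE /= -sumrB.
  by apply: eq_bigr => a _; rewrite mulrBl.
rewrite /= big1 // => a _; rewrite of_ ?mul0r //.
by apply: leq_trans lt_md; apply: bmdeg.
Qed.

Lemma fcompB n k (f h : {fps R[n]}) (g : n.-tuple {fps R[k]}) :
  (f - h) \fPo g = (f \fPo g) - (h \fPo g).
Proof. exact: (proj1 (fps_cont_fcomp g)). Qed.

Lemma fcompD n k (f h : {fps R[n]}) (g : n.-tuple {fps R[k]}) :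
  (f + h) \fPo g = (f \fPo g) + (h \fPo g).
Proof. exact: (fps_contD _ _ (fps_cont_fcomp g)). Qed.

Lemma fcomp_0 n k (f : {fps R[n]}) (g : n.-tuple {fps R[k]}) :
  (f \fPo g) 0%MM = f 0%MM.
Proof.
have lt0 : (mdeg (0%MM : 'X_{1..n}) < (mdeg (0%MM : 'X_{1..k})).+1)%N.
  by rewrite !mdeg0.
rewrite /= (bigD1 (BMultinom lt0)) //= [X in _ + X]big1 ?addr0.
  by rewrite big1 ?fps1E ?fpsCE ?eqxx ?mulr1 // => i _; rewrite mnm0E.
move=> a; rewrite bmeqP /= -mdeg_eq0.
by have := bmdeg a; rewrite [X in (_ < X.+1)%N]mdeg0 ltnS leqn0 => ->.
Qed.

Lemma fcomp_ord1 n k (f : {fps R[n]}) (g : n.-tuple {fps R[k]}) :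
  fps_ord 1 f -> fps_ord 1 (f \fPo g).
Proof. exact: (proj2 (fps_cont_fcomp g)). Qed.

Context (n k : nat) (g : n.-tuple {fps R[k]}).
Context (g_ord : forall i, fps_ord 1 (tnth g i)).

Lemma fps_ord_monomial (a : 'X_{1..n}) :
  fps_ord (mdeg a) (\prod_(i < n) tnth g i ^+ a i).
Proof.
rewrite mdegE; apply: (big_ind2 (@fps_ord k R)) => //.
  by move=> d f e h; apply: fps_ordM.
by move=> i _; rewrite -[X in fps_ord X]muln1; apply: fps_ordX.
Qed.

Lemma fcomp_mon c a :
  fps_mon c a \fPo g = fpsC k c * \prod_(i < n) tnth g i ^+ a i.
Proof.
apply: fpsP => m; rewrite fpsC_mulE /=.
have [lt_am|lt_ma] := ltnP (mdeg a) (mdeg m).+1.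
  rewrite (bigD1 (BMultinom lt_am)) //= eqxx [X in _ + X]big1 ?addr0 // => b.
  by rewrite bmeqP /= => /negPf ->; rewrite mul0r.
(* Here the truncated sum omits the exponent [a]. Nothing is lost, since the product has order
   [mdeg a], which exceeds the degree of [m]. *)
rewrite (fps_ord_monomial lt_ma) mulr0 big1 // => b _.
case: eqP => [eq_b|]; rewrite ?mul0r //.
by have := bmdeg b; rewrite eq_b ltnS leqNgt lt_ma.
Qed.

Lemma fcompC c : fpsC n c \fPo g = fpsC k c.
Proof.
rewrite (fcomp_mon c 0) big1 ?mulr1 // => i _.
by rewrite mnm0E.
Qed.

Lemma fcomp1 : 1 \fPo g = 1. Proof. exact: fcompC. Qed.

Lemma fcompX i : fpsX R i \fPo g = tnth g i.
Proof.
rewrite (fcomp_mon 1 U_(i)) mul1r (bigD1 i) //= mnm1E eqxx expr1.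
rewrite big1 ?mulr1 // => j ne_ji.
by rewrite mnm1E eq_sym (negPf ne_ji).
Qed.

(** Both sides are additive and continuous in each factor, so the factors are reduced to monomials
    one at a time; for monomials the exponents add. *)
Lemma fcompM f h : (f * h) \fPo g = (f \fPo g) * (h \fPo g).
Proof.
have cg := fps_cont_fcomp g.
move: f; apply: fps_cont_ext => [||c a].
- by apply: (fps_cont_comp cg); apply/fps_cont_mulr/fps_cont_id.
- exact: fps_cont_mulr.
rewrite mulrC [RHS]mulrC; move: h; apply: fps_cont_ext => [||e b].
- by apply: (fps_cont_comp cg); apply/fps_cont_mulr/fps_cont_id.
- exact: fps_cont_mulr.
rewrite fps_monM !fcomp_mon fpsCM.
under eq_bigr do rewrite mnmDE exprD.
by rewrite big_split /=; ring.
Qed.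

Lemma fcomp_expr f l : (f ^+ l) \fPo g = (f \fPo g) ^+ l.
Proof. by elim: l => [|l IH]; rewrite ?fcomp1 // !exprS fcompM IH. Qed.

Lemma fcomp_prod (I : Type) (r : seq I) (P : pred I) (F : I -> {fps R[n]}) :
  (\prod_(i <- r | P i) F i) \fPo g = \prod_(i <- r | P i) (F i \fPo g).
Proof.
by apply: (big_morph (fun f => f \fPo g)) => [f h|]; rewrite ?fcompM ?fcomp1.
Qed.

End Composition.

(** Continuity in [f] leaves monomials, where multiplicativity of substitution suffices. The
    composed tuple [gh] is specified by its entries so that an explicit tuple can be supplied. *)
Lemma fcompA (R : comPzRingType) n k l (f : {fps R[n]})
    (g : n.-tuple {fps R[k]}) (h : k.-tuple {fps R[l]})
    (gh : n.-tuple {fps R[l]}) :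
  (forall i, fps_ord 1 (tnth g i)) -> (forall i, fps_ord 1 (tnth h i)) ->
  (forall i, tnth gh i = tnth g i \fPo h) ->
  (f \fPo g) \fPo h = f \fPo gh.
Proof.
move=> og oh ghE; have ogh i : fps_ord 1 (tnth gh i).
  by rewrite ghE; apply: fcomp_ord1.
move: f; apply: fps_cont_ext => [||c a].
- exact: (fps_cont_comp (fps_cont_fcomp h) (fps_cont_fcomp g)).
- exact: fps_cont_fcomp.
rewrite !fcomp_mon // fcompM // fcompC // fcomp_prod //.
by congr (_ * _); apply: eq_bigr => i _; rewrite fcomp_expr // ghE.
Qed.

(** * Linear terms of a substitution *)

Section LinearPart.
Context (R : comPzRingType).

Lemma fps_linear_part n (f : {fps R[n]}) : fps_ord 1 f ->
  fps_ord 2 (f - \sum_i fpsC n (f U_(i)%MM) * fpsX R i).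
Proof.
move=> of_ m; rewrite fpsBE fps_sumE ltnS leq_eqVlt ltnS leqn0 => /orP[].
  rewrite mdeg_eq1 => /existsP[j /eqP ->]; rewrite (bigD1 j) // big1.
    by rewrite fpsC_mulE /= eqxx mulr1 addr0 subrr.
  move=> i ne_ij; rewrite fpsC_mulE /=.
  case: eqP => [/mnmP/(_ i)|]; rewrite ?mulr0 // !mnm1E eqxx eq_sym.
  by rewrite (negPf ne_ij).
rewrite mdeg_eq0 => /eqP ->; rewrite of_ ?mdeg0 // big1 ?subrr // => i _.
by rewrite fpsC_mulE fpsX_ord1 ?mdeg0 ?mulr0.
Qed.

(** Chain rule at the origin: [f] minus its linear part has order 2, and substitution preserves
    this, so only the linear part contributes. *)
Lemma fcomp_coef1 n k (f : {fps R[n]}) (g : n.-tuple {fps R[k]}) j :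
  fps_ord 1 f -> (forall i, fps_ord 1 (tnth g i)) ->
  (f \fPo g) U_(j)%MM = \sum_i f U_(i)%MM * tnth g i U_(j)%MM.
Proof.
move=> of_ og; have := fps_linear_part of_; set l := \sum_i _ => ol.
have -> : f = (f - l) + l by ring.
rewrite fcompD fpsDE (proj2 (fps_cont_fcomp g) _ _ ol) ?mdeg1 // add0r.
rewrite /l (big_morph (fun h => h \fPo g) (id1 := 0) (op1 := +%R)); last first.
- exact: (fps_cont0 (fps_cont_fcomp g)).
- by move=> u v; rewrite fcompD.
rewrite fps_sumE; apply: eq_bigr => i _.
rewrite fcompM // fcompC // fcompX // fpsC_mulE -/l.
by rewrite subrK.
Qed.

End LinearPart.

(** The index of [X1] carries its own proof of the bound, so it is compared with [ord0] by value. *)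
Lemma X1E (R : comPzRingType) : @X1 R = fpsX R ord0.
Proof. by congr fpsX; apply: val_inj. Qed.

Lemma X2E (R : comPzRingType) : @X2 R = fpsX R ord0.
Proof. by congr fpsX; apply: val_inj. Qed.

Lemma Y2E (R : comPzRingType) : @Y2 R = fpsX R (lift ord0 ord0).
Proof. by congr fpsX; apply: val_inj. Qed.

(** * Substitution of explicit tuples, and divisibility by a variable *)

Section Tuples.
Context (R : comPzRingType).

Lemma fps_ord_tuple1 k (u : {fps R[k]}) :
  fps_ord 1 u -> forall i : 'I_1, fps_ord 1 (tnth [tuple u] i).
Proof. by move=> ou [[|//] i]. Qed.

Lemma fps_ord_tuple2 k (u v : {fps R[k]}) :
  fps_ord 1 u -> fps_ord 1 v ->
  forall i : 'I_2, fps_ord 1 (tnth [tuple u; v] i).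
Proof. by move=> ou ov [[|[|//]] i]. Qed.

Lemma fps_ord_tuple3 k (u v w : {fps R[k]}) :
  fps_ord 1 u -> fps_ord 1 v -> fps_ord 1 w ->
  forall i : 'I_3, fps_ord 1 (tnth [tuple u; v; w] i).
Proof. by move=> ou ov ow [[|[|[|//]]] i]. Qed.

Lemma fcompA1 k l (f : {fps R[1]}) (u : {fps R[k]})
    (h : k.-tuple {fps R[l]}) :
  fps_ord 1 u -> (forall i, fps_ord 1 (tnth h i)) ->
  (f \fPo [tuple u]) \fPo h = f \fPo [tuple u \fPo h].
Proof.
move=> ou oh; apply: fcompA => //; first exact: fps_ord_tuple1.
by case=> [[|//] i].
Qed.

Lemma fcompA2 k l (f : {fps R[2]}) (u v : {fps R[k]})
    (h : k.-tuple {fps R[l]}) :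
  fps_ord 1 u -> fps_ord 1 v -> (forall i, fps_ord 1 (tnth h i)) ->
  (f \fPo [tuple u; v]) \fPo h = f \fPo [tuple u \fPo h; v \fPo h].
Proof.
move=> ou ov oh; apply: fcompA => //; first exact: fps_ord_tuple2.
by case=> [[|[|//]] i].
Qed.

Lemma fps_monX n i k : fpsX R i ^+ k = fps_mon 1 (U_(i) *+ k)%MM :> {fps R[n]}.
Proof.
elim: k => [|k IH]; first by rewrite mulm0n.
by rewrite exprS IH (fps_monM 1 1 U_(i)) mulr1 mulmS.
Qed.

Lemma fps_mon_prod n c (a : 'X_{1..n}) :
  fps_mon c a = fpsC n c * \prod_i fpsX R i ^+ a i.
Proof.
have -> : \prod_i fpsX R i ^+ a i = fps_mon 1 a.
  under eq_bigr do rewrite fps_monX.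
  rewrite [in RHS](multinomUE_id a).
  apply: (big_ind2 (fun u b => u = fps_mon 1 b)) => //.
  by move=> u b v d -> ->; rewrite fps_monM mulr1.
by rewrite (fps_monM c 1 0) add0m mulr1.
Qed.

Lemma fcomp_id n (f : {fps R[n]}) (g : n.-tuple {fps R[n]}) :
  (forall i, tnth g i = fpsX R i) -> f \fPo g = f.
Proof.
move=> gX; have og i : fps_ord 1 (tnth g i) by rewrite gX; apply: fpsX_ord1.
move: f; apply: fps_cont_ext => [||c a].
- exact: fps_cont_fcomp.
- exact: fps_cont_id.
rewrite fcomp_mon // fps_mon_prod; congr (_ * _).
by apply: eq_bigr => i _; rewrite gX.
Qed.

Lemma fps_divXK n i k (f : {fps R[n]}) : fps_divX i k (fpsX R i ^+ k * f) = f.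
Proof.
apply: fpsP => m; rewrite fps_monX.
transitivity ((fps_mon 1 (U_(i) *+ k)%MM * f) (m + U_(i) *+ k)%MM) => //.
rewrite fps_mon_mulE lem_addl mul1r.
by congr (f _); apply: addmK.
Qed.

(** The terms free of the first variable, collected by [p], make up [f(0, y)], which vanishes; all
    other terms are divisible by that variable. *)
Lemma fps_mul_divX (f : {fps R[2]}) :
  f \fPo [tuple 0; X1] = 0 -> f = X2 * fps_divX ord0 1 f.
Proof.
move=> f0; pose p (h : {fps R[2]}) : {fps R[2]} :=
  FPS (fun m => if m ord0 == 0%N then h m else 0).
pose g : 2.-tuple {fps R[2]} := [tuple 0; Y2].
have og i : fps_ord 1 (tnth g i).
  by apply: fps_ord_tuple2 => //; apply: fpsX_ord1.
have fE : f = X2 * fps_divX ord0 1 f + p f.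
  apply: fpsP => m; rewrite fpsDE X2E fpsX_mulE /=.
  case: ifPn => [le_m|nle_m].
    rewrite mulm1n submK //.
    have /mnm_lepP/(_ ord0) := le_m; rewrite mnm1E eqxx lt0n => /negPf ->.
    by rewrite addr0.
  rewrite add0r; case: eqP => // /eqP m0; case/negP: nle_m.
  apply/mnm_lepP => i; rewrite mnm1E; case: eqP => // <-.
  by rewrite lt0n.
have pK h : p h \fPo g = p h.
  move: h; apply: fps_cont_ext => [||c a].
  - apply: (fps_cont_comp (fps_cont_fcomp g)).
    split=> [h h'|d h oh m lt_m] /=.
      by apply: fpsP => m; rewrite fpsBE /=; case: ifP; rewrite ?subr0.
    by rewrite oh // if_same.
  - split=> [h h'|d h oh m lt_m] /=.
      by apply: fpsP => m; rewrite fpsBE /=; case: ifP; rewrite ?subr0.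
    by rewrite oh // if_same.
  have [a0|a0] := eqVneq (a ord0) 0%N; last first.
    have -> : p (fps_mon c a) = 0.
      apply: fpsP => m /=; case: ifP => // /eqP m0.
      by case: eqP => // eq_m; rewrite -eq_m m0 in a0.
    exact: (fps_cont0 (fps_cont_fcomp g)).
  have -> : p (fps_mon c a) = fps_mon c a.
    by apply: fpsP => m /=; case: (m =P a) => [->|]; rewrite ?a0 ?if_same.
  rewrite fcomp_mon // fps_mon_prod; congr (_ * _).
  rewrite !big_ord_recl !big_ord0 a0 !expr0.
  suff -> : tnth g (lift ord0 ord0) = fpsX R (lift ord0 ord0) by [].
  exact: Y2E.
(* The hypothesis lives in one variable; renaming that variable to [Y2] brings it into two. *)
have fg0 : f \fPo g = 0.
  have := congr1 (fun h => h \fPo [tuple Y2]) f0.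
  have oY : forall i : 'I_1, fps_ord 1 (tnth [tuple @Y2 R] i).
    by apply: fps_ord_tuple1; apply: fpsX_ord1.
  rewrite fcompA2 //; last exact: fpsX_ord1.
  rewrite !(fps_cont0 (fps_cont_fcomp _)) fcompX //.
move: fg0; rewrite {1}fE fcompD fcompM // fcompX // mul0r add0r pK => pf0.
by rewrite {1}fE pf0 addr0.
Qed.

End Tuples.

(** * Formal and compositional inverses *)

Section FixedPoint.
Context (R : comPzRingType) (n : nat) (Phi : {fps R[n]} -> {fps R[n]}).
Context (Phi_ord : forall u, fps_ord 1 u -> fps_ord 1 (Phi u)).
Context (Phi_contr : forall d u v, fps_ord 1 u -> fps_ord 1 v ->
  fps_ord d (u - v) -> fps_ord d.+1 (Phi u - Phi v)).

(** Banach's fixed point theorem: the iterates of [Phi] from 0 converge because each application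
    gains one order on differences. *)
Lemma fps_fixed_point : exists2 u, fps_ord 1 u & Phi u = u.
Proof.
pose w d := iter d Phi 0.
have ow d : fps_ord 1 (w d) by elim: d => // d IH; apply: Phi_ord.
have wS d : fps_ord d.+1 (w d.+1 - w d).
  elim: d => [|d IH]; first exact: fps_ordB (ow 1%N) (ow 0%N).
  exact: (Phi_contr (ow _) (ow _) IH).
have wD d e : fps_ord d.+1 (w (d + e)%N - w d).
  elim: e => [|e IH]; first by rewrite addn0 subrr.
  have -> : w (d + e.+1)%N - w d =
    (w (d + e).+1 - w (d + e)%N) + (w (d + e)%N - w d) by rewrite addnS; ring.
  by apply: fps_ordD => //; apply: fps_ordW (wS _); rewrite ltnS leq_addr.
(* All stages from [d] on agree in degrees up to [d], so the limit coefficient at [m] is already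
   reached at stage [mdeg m]. *)
pose u : {fps R[n]} := FPS (fun m => w (mdeg m) m).
have ou : fps_ord 1 u.
  by move=> m lt_m; apply: ow.
have uw d : fps_ord d.+1 (u - w d).
  move=> m lt_m; have := wD (mdeg m) (d - mdeg m)%N m (ltnSn _).
  rewrite subnKC // !fpsBE /= => e.
  by rewrite -[RHS]oppr0 -e opprB.
exists u => //; apply/eqP; rewrite -subr_eq0; apply/eqP.
apply: fps_ord_eq0 => d.
have -> : Phi u - u = (Phi u - Phi (w d)) - (u - w d.+1).
  by rewrite /w /= -/(w d); ring.
apply: (@fps_ordW _ _ d d.+1) => //; apply: fps_ordB.
  exact: Phi_contr ou (ow d) (fps_ordW (leqnSn d) (uw d)).
exact: fps_ordW (uw _).
Qed.

End FixedPoint.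

Section Implicit.
Context (R : comPzRingType).

(** The difference of powers is [u - v] times a form of degree [k] in [u] and [v], which has order
    [k]. *)
Lemma fps_ord_subX d n (u v : {fps R[n]}) k :
  fps_ord 1 u -> fps_ord 1 v -> fps_ord d (u - v) ->
  fps_ord (k + d) (u ^+ k.+1 - v ^+ k.+1).
Proof.
move=> ou ov od; elim: k => [|k IH]; first by rewrite !expr1.
have -> : u ^+ k.+2 - v ^+ k.+2 =
    u * (u ^+ k.+1 - v ^+ k.+1) + v ^+ k.+1 * (u - v).
  by rewrite ![_ ^+ k.+2]exprS; ring.
apply: fps_ordD; first by rewrite addSn -add1n; apply: fps_ordM.
by apply: fps_ordM => //; rewrite -[X in fps_ord X]muln1; apply: fps_ordX.
Qed.

(** A term with exponents [a0] and [k.+1] contributes a difference of order [a0 + k + d], and total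
    degree at least 2 makes [a0 + k] positive. Terms free of the second variable cancel. *)
Lemma fcomp_contr n d (f : {fps R[2]}) (x u v : {fps R[n]}) :
  fps_ord 2 f -> fps_ord 1 x -> fps_ord 1 u -> fps_ord 1 v ->
  fps_ord d (u - v) ->
  fps_ord d.+1 ((f \fPo [tuple x; u]) - (f \fPo [tuple x; v])).
Proof.
move=> of_ ox ou ov od.
pose L h := (h \fPo [tuple x; u]) - (h \fPo [tuple x; v]).
rewrite -/(L f).
have LD h h' : L (h + h') = L h + L h' by rewrite /L !fcompD; ring.
have oL e h : fps_ord e h -> fps_ord e (L h).
  by move=> oh; apply: fps_ordB; apply: (proj2 (fps_cont_fcomp _)).
(* The remainder of this truncation already has the required order, which leaves finitely many
   monomials. *)
have tr := @fps_trunc_ord 2 R d.+1 f; set t := \sum_a _ in tr.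
have -> : f = (f - t) + t by ring.
rewrite LD; apply: fps_ordD; first exact: oL.
rewrite /t; apply: (big_ind (fun h => fps_ord d.+1 (L h))) => [||a _].
- exact: oL.
- by move=> h h' oh oh'; rewrite LD; apply: fps_ordD.
have [lt_a|le_a] := ltnP (mdeg (a : 'X_{1..2})) 2.
  by rewrite of_ //; apply: oL => m _ /=; rewrite if_same.
rewrite /L !fcomp_mon; [|exact: fps_ord_tuple2|exact: fps_ord_tuple2].
rewrite !big_ord_recl !big_ord0 /=.
set i := lift ord0 ord0; set a0 := (bmnm a) ord0; set a1 := (bmnm a) i.
have {le_a} : (2 <= a0 + a1)%N.
  by move: le_a; rewrite mdegE !big_ord_recl big_ord0 addn0.
case: a1 => [|k] le_a.
  by rewrite !expr0 subrr.
have -> : fpsC n (f a) * (x ^+ a0 * (u ^+ k.+1 * 1)) -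
    fpsC n (f a) * (x ^+ a0 * (v ^+ k.+1 * 1)) =
    fpsC n (f a) * (x ^+ a0 * (u ^+ k.+1 - v ^+ k.+1)) by ring.
apply: fps_ordMl; apply: (@fps_ordW _ _ _ (a0 * 1 + (k + d))); first by lia.
by apply: fps_ordM; [apply: fps_ordX|apply: fps_ord_subX].
Qed.

(** Implicit function theorem: [c] inverts the partial derivative of [H] in the second variable at
    the origin. *)
Lemma fps_implicit (H : {fps R[2]}) c :
  fps_ord 1 H -> H U_(lift ord0 ord0)%MM * c = 1 ->
  exists2 u : {fps R[1]}, fps_ord 1 u & H \fPo [tuple X1; u] = 0.
Proof.
set e := H _ => oH ec.
have oX : fps_ord 1 (@X1 R) by apply: fpsX_ord1.
have eC : fpsC 1 e * fpsC 1 c = 1 by rewrite -fpsCM ec.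
pose Y : {fps R[2]} := fpsX R (lift ord0 ord0).
pose X : {fps R[2]} := fpsX R ord0.
pose H2 := H - (fpsC 2 (H U_(ord0)%MM) * X + fpsC 2 e * Y).
have oH2 : fps_ord 2 H2.
  by have := fps_linear_part oH; rewrite !big_ord_recl big_ord0 addr0.
have HE u : fps_ord 1 u -> H \fPo [tuple X1; u] =
    (H2 \fPo [tuple X1; u]) + (fpsC 1 (H U_(ord0)%MM) * X1 + fpsC 1 e * u).
  move=> ou; have og := fps_ord_tuple2 oX ou.
  have {1}-> : H = H2 + (fpsC 2 (H U_(ord0)%MM) * X + fpsC 2 e * Y).
    by rewrite /H2; ring.
  by rewrite !fcompD !fcompM // !fcompC // !fcompX.
(* Newton iteration with the slope frozen at the origin. The linear term of [H] in [u] cancels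
   against [u], so only [H2], of order 2, enters differences and [Phi] is a contraction. *)
pose Phi u := u - fpsC 1 c * (H \fPo [tuple X1; u]).
have [||u ou uE] := @fps_fixed_point R 1 Phi.
- move=> u ou; apply: fps_ordB => //; apply: fps_ordMl.
  exact: fcomp_ord1.
- move=> d u v ou ov od.
  have -> : Phi u - Phi v = - (fpsC 1 c *
      ((H2 \fPo [tuple X1; u]) - (H2 \fPo [tuple X1; v]))).
    rewrite /Phi !HE //.
    set a := H2 \fPo _; set b := H2 \fPo _; set l := fpsC 1 _ * X1.
    transitivity ((u - v) - fpsC 1 e * fpsC 1 c * (u - v) - fpsC 1 c * (a - b)).
      by ring.
    by rewrite eC; ring.
  by apply/fps_ordN/fps_ordMl/fcomp_contr.
exists u => //.
have cH : fpsC 1 c * (H \fPo [tuple X1; u]) = 0.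
  have -> : fpsC 1 c * (H \fPo [tuple X1; u]) = u - Phi u by rewrite /Phi; ring.
  by rewrite uE subrr.
by rewrite -[LHS]mul1r -eC -mulrA cH mulr0.
Qed.

Lemma fcomp1_coef1 (g h : {fps R[1]}) : fps_ord 1 g -> fps_ord 1 h ->
  (g \fPo [tuple h]) U_(ord0)%MM = g U_(ord0)%MM * h U_(ord0)%MM.
Proof.
move=> og oh; rewrite fcomp_coef1 //; last exact: fps_ord_tuple1.
by rewrite big_ord_recl big_ord0 addr0.
Qed.

Lemma X1_coef : (@X1 R) U_(ord0)%MM = 1.
Proof. by rewrite X1E /= eqxx. Qed.

Lemma fcomp1_id (g : {fps R[1]}) : g \fPo [tuple X1] = g.
Proof. by apply: fcomp_id => i; rewrite ord1 X1E. Qed.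

Lemma fcompX1 n (u : {fps R[n]}) : fps_ord 1 u -> X1 \fPo [tuple u] = u.
Proof. by move=> ou; rewrite fcompX //; apply: fps_ord_tuple1. Qed.

(** The implicit function theorem is applied to [g(y) - x]. *)
Lemma fcomp_right_inverse (g : {fps R[1]}) c :
  fps_ord 1 g -> g U_(ord0)%MM * c = 1 ->
  exists2 h, fps_ord 1 h & g \fPo [tuple h] = X1.
Proof.
move=> og gc; pose Y : {fps R[2]} := fpsX R (lift ord0 ord0).
pose X : {fps R[2]} := fpsX R ord0.
have oY : fps_ord 1 Y by apply: fpsX_ord1.
have oX : fps_ord 1 X by apply: fpsX_ord1.
pose H := (g \fPo [tuple Y]) - X.
have [||h oh hE] := @fps_implicit H c.
- by apply: fps_ordB => //; apply: fcomp_ord1.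
- rewrite /H fpsBE fcomp_coef1 //; last exact: fps_ord_tuple1.
  rewrite big_ord_recl big_ord0 addr0 /= eqxx mulr1 [X in _ - X](_ : _ = 0).
    by rewrite subr0.
  by case: eqP => // /mnmP/(_ ord0); rewrite !mnm1E.
exists h => //; move: hE; have oXh := fps_ord_tuple2 (fpsX_ord1 R (ord0 : 'I_1)) oh.
rewrite -X1E in oXh.
rewrite /H fcompB fcompA1 // !fcompX // => /eqP; rewrite subr_eq0 => /eqP.
exact.
Qed.

(** A right inverse [h] of [g] has a right inverse [k] itself, its linear coefficient being
    invertible by the chain rule. Then [k = g(h(k)) = g], so [h] is two-sided and [xget] does not
    fall back on its default 0. *)
Lemma compositional_inverseP (g : {fps R[1]}) c :
  fps_ord 1 g -> g U_(ord0)%MM * c = 1 ->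
  let h := compositional_inverse g in
  fps_ord 1 h /\ g \fPo [tuple h] = X1.
Proof.
move=> og gc.
suff [h hP] : exists h : {fps R[1]},
    [/\ h 0%MM = 0, g \fPo [tuple h] = X1 & h \fPo [tuple g] = X1].
  rewrite /compositional_inverse.
  case: classical_sets.xgetP => [k -> [k0 gk _]|/(_ h)]; last by case.
  by split => //; apply/fps_ord1.
have [h oh gh] := fcomp_right_inverse og gc.
have [|k ok hk] := @fcomp_right_inverse h (g U_(ord0)%MM) oh.
  by rewrite mulrC -fcomp1_coef1 // gh X1_coef.
have kg : k = g.
  rewrite -[k]fcompX1 // -gh fcompA1 //; last exact: fps_ord_tuple1.
  by rewrite hk fcomp1_id.
exists h; split => //; last by rewrite -kg.
exact/fps_ord1.
Qed.

End Implicit.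

(** * The square root *)

(** [ff x k] is the falling factorial. In the induction the new factor splits as
    [a + b - n = (a - k) + (b - (n - k))], and Pascal's rule regroups the terms. *)
Lemma falling_Vandermonde (R : comPzRingType) (a b : R) n
    (ff := fun (x : R) k => \prod_(j < k) (x - j%:R)) :
  \sum_(k < n.+1) 'C(n, k)%:R * ff a k * ff b (n - k)%N = ff (a + b) n.
Proof.
have ffS x k : ff x k.+1 = ff x k * (x - k%:R) by rewrite /ff big_ord_recr.
elim: n => [|n IH].
  by rewrite big_ord1 /ff !big_ord0 !mulr1.
rewrite ffS -IH mulr_suml.
transitivity (\sum_(k < n.+1) ('C(n, k)%:R * ff a k.+1 * ff b (n - k)%N +
                               'C(n, k)%:R * ff a k * ff b (n.+1 - k)%N)).
  rewrite big_split /=.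
  rewrite big_ord_recl /= bin0.
  rewrite [X in _ = X + _]big_ord_recr [X in _ = _ + X]big_ord_recl /= binn bin0.
  rewrite subnn subn0.
  under eq_bigr => i _ do rewrite /bump /= add1n binS natrD subSS !mulrDl.
  rewrite big_split /= big_ord_recr /= bin_small // subnn.
  under [X in _ = _ + (_ + X)]eq_bigr => i _ do rewrite /bump /= add1n subSS.
  rewrite [X in _ + (X + _ + _)](_ : _ =
     \sum_(i < n) 'C(n, i.+1)%:R * ff a i.+1 * ff b (n - i)%N) //.
  rewrite [X in _ + (_ + X)]big_ord_recr /= binn subnn.
  by rewrite mul0r; ring.
apply: eq_bigr => k _; have le_kn : (k <= n)%N by rewrite -ltnS.
rewrite subSn // !ffS.
have -> : (n%:R : R) = k%:R + (n - k)%:R by rewrite -natrD subnKC.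
by ring.
Qed.

(* The base ring may have torsion, so the convolution identity for the binomial
   coefficients of 1/2 is proved over [rat] and transferred through [int] by
   clearing the powers of 2. *)
Definition half_binomial_num (k : nat) : int :=
  if k is j.+1 then (-1) ^+ j * ('C(j.*2, j) %/ j.+1)%:R *+ 2 else 1.

Lemma half_binomial_numE (R : comPzRingType) (half : R) k :
  half_binomial half k = (half_binomial_num k)%:~R * half ^+ k.*2.
Proof.
case: k => [|j]; first by rewrite mulr1.
rewrite /half_binomial /half_binomial_num; congr (_ * _).
by rewrite rmorphMn rmorphM /= rmorphXn /= rmorphN1 rmorph_nat.
Qed.

(** Vandermonde at [a = b = 1/2] turns the convolution of the binomial coefficients of 1/2 into
    those of 1, namely 1, 1, 0, 0 and so on; [4 ^+ n] clears the denominators. *)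
Lemma half_binomial_num_conv n :
  \sum_(k < n.+1) half_binomial_num k * half_binomial_num (n - k)%N =
  if (n < 2)%N then 4 ^+ n else 0.
Proof.
pose half : rat := 2^-1; have h2 : 2 * half = 1 by [].
have h4 : 4 * half ^+ 2 = 1 by [].
have conv : \sum_(k < n.+1) half_binomial half k * half_binomial half (n - k)%N
    = if (n < 2)%N then 1 else 0.
  have nz : n`!%:R != 0 :> rat by rewrite pnatr_eq0 -lt0n fact_gt0.
  apply: (mulIf nz); rewrite mulr_suml.
  transitivity (\prod_(j < n) (half + half - j%:R)).
    rewrite -falling_Vandermonde; apply: eq_bigr => k _.
    have le_kn : (k <= n)%N by rewrite -ltnS.
    rewrite -!half_binomialE // -(@bin_fact n k) // !natrM.
    by ring.
  have -> : half + half = 1 by [].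
  case: n {nz} => [|[|n]] /=.
  - by rewrite big_ord0 mul1r.
  - by rewrite big_ord1 subr0 mul1r.
  (* The falling factorial of 1 of length at least 2 contains the factor [1 - 1]. *)
  - by rewrite !big_ord_recl subrr mul0r mulr0 mul0r.
apply: (@intr_inj rat).
have p4 : 4 ^+ n * half ^+ n.*2 = 1.
  by rewrite -mul2n exprM -exprMn h4 expr1n.
have hu : half ^+ n.*2 \is a GRing.unit by rewrite unitrX.
apply: (mulIr hu); rewrite rmorph_sum /= mulr_suml.
transitivity (\sum_(k < n.+1) half_binomial half k * half_binomial half (n - k)%N).
  apply: eq_bigr => k _; rewrite !half_binomial_numE rmorphM /=.
  have -> : (n.*2 = k.*2 + (n - k).*2)%N by rewrite -doubleD subnKC // -ltnS.
  by rewrite exprD; ring.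
rewrite conv; case: ifP => _; last by rewrite mul0r.
by rewrite rmorphXn /= p4.
Qed.

Lemma half_binomial_conv (R : comPzRingType) (half : R) n : 2 * half = 1 ->
  \sum_(k < n.+1) half_binomial half k * half_binomial half (n - k)%N =
  if (n < 2)%N then 1 else 0.
Proof.
move=> h2; have h4 : 4 * half ^+ 2 = 1.
  by transitivity ((2 * half) ^+ 2); [ring|rewrite h2 expr1n].
have p4 : 4 ^+ n * half ^+ n.*2 = 1.
  by rewrite -mul2n exprM -exprMn h4 expr1n.
transitivity ((\sum_(k < n.+1)
  half_binomial_num k * half_binomial_num (n - k)%N)%:~R * half ^+ n.*2).
  rewrite rmorph_sum /= mulr_suml.
  apply: eq_bigr => k _; rewrite !half_binomial_numE rmorphM /=.
  have -> : (n.*2 = k.*2 + (n - k).*2)%N by rewrite -doubleD subnKC // -ltnS.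
  by rewrite exprD; ring.
rewrite half_binomial_num_conv; case: ifP => _; last by rewrite mul0r.
by rewrite rmorphXn /= p4.
Qed.

Section Sqrt.
Context (R : comPzRingType) (half : R).
Context (half_eq : 2 * half = 1).

Lemma mnm1_val (m : 'X_{1..1}) i : m i = mdeg m.
Proof. by rewrite mdegE big_ord1 ord1. Qed.

Lemma mnm1_mdeg (m : 'X_{1..1}) : m = (U_(ord0) *+ mdeg m)%MM.
Proof. by apply/mnmP => i; rewrite !mnm1_val mdegMn mdeg1 mul1n. Qed.

(** [g] is the binomial series for the square root of [1 + x]; the coefficients of its square are
    the convolutions just computed. *)
Lemma half_binomial_sqr :
  let g : {fps R[1]} := FPS (fun m => half_binomial half (mdeg m)) in
  g ^+ 2 = 1 + X1.
Proof.
move=> g; apply: fpsP => m; set n := mdeg m.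
transitivity (\sum_(k < n.+1) half_binomial half k * half_binomial half (n - k)%N).
  rewrite expr2 [LHS]/=.
  have dU (i : 'I_n.+1) : (mdeg (U_(ord0 : 'I_1) *+ i)%MM < n.+1)%N.
    by rewrite mdegMn mdeg1 mul1n.
  pose F (i : 'I_n.+1) := BMultinom (dU i).
  rewrite (reindex F) /=; last first.
    exists (fun k => inord (mdeg (bmnm k))) => [i _|k _]; apply: val_inj => /=.
      by rewrite mdegMn mdeg1 mul1n inordK.
    by rewrite inordK ?bmdeg // -mnm1_mdeg.
  apply: eq_big => [i|i le_i].
    apply/mnm_lepP => j; rewrite !mnm1_val mdegMn mdeg1 mul1n.
    by rewrite -ltnS.
  rewrite mdegMn mdeg1 mul1n; congr (_ * half_binomial _ _).
  by have := congr1 (@mdeg 1) (submK le_i); rewrite mdegD mdegMn mdeg1; lia.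
rewrite half_binomial_conv // fpsDE fps1E fpsCE X1E /=.
have := mnm1_mdeg m; rewrite -/n.
case: n => [|[|n]] -> /=.
- rewrite mulm0n eqxx; case: eqP => [/(congr1 (@mdeg 1))|]; rewrite ?addr0 //.
  by rewrite mdeg0 mdeg1.
- by rewrite mulm1n eqxx mnm1_eq0 add0r.
- rewrite -mdeg_eq0 mdegMn mdeg1 mul1n /= add0r; case: eqP => //.
  by move/(congr1 (@mdeg 1)); rewrite mdegMn mdeg1 mul1n.
Qed.

(** The root [s] and [v] have the same square, so [(s - v) * (s + v) = 0], and [s + v] can be
    cancelled because its constant term 2 is inverted by [half]. *)
Lemma fps_sqrt_sqr n (v : {fps R[n]}) :
  v 0%MM = 1 -> fps_sqrt half (v ^+ 2) = v.
Proof.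
move=> v0; have o : fps_ord 1 (v ^+ 2 - 1).
  by apply/fps_ord1; rewrite fpsBE expr2 fps0M v0 fps1E fpsCE eqxx mulr1 subrr.
have ot := fps_ord_tuple1 o.
set s := fps_sqrt half _.
have s2 : s ^+ 2 = v ^+ 2.
  rewrite /s /fps_sqrt -fcomp_expr // half_binomial_sqr fcompD fcomp1 //.
  by rewrite fcompX1 //; ring.
have s0 : s 0%MM = 1 by rewrite /s /fps_sqrt fcomp_0 /= mdeg0.
apply/eqP; rewrite -subr_eq0; apply/eqP.
apply: (@fps_mul_eq0 _ _ _ (s + v) half).
  by rewrite fpsDE s0 v0.
by transitivity (s ^+ 2 - v ^+ 2); [ring|rewrite s2 subrr].
Qed.

End Sqrt.

(** * The group operation on series without constant term *)

Section Variables.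
Context (R : comPzRingType).

Lemma X1_ord1 : fps_ord 1 (@X1 R). Proof. exact: fpsX_ord1. Qed.
Lemma X2_ord1 : fps_ord 1 (@X2 R). Proof. exact: fpsX_ord1. Qed.
Lemma Y2_ord1 : fps_ord 1 (@Y2 R). Proof. exact: fpsX_ord1. Qed.
Lemma X3_ord1 : fps_ord 1 (@X3 R). Proof. exact: fpsX_ord1. Qed.
Lemma Y3_ord1 : fps_ord 1 (@Y3 R). Proof. exact: fpsX_ord1. Qed.
Lemma Z3_ord1 : fps_ord 1 (@Z3 R). Proof. exact: fpsX_ord1. Qed.

Lemma fcompX2 k (u v : {fps R[k]}) :
  fps_ord 1 u -> fps_ord 1 v -> X2 \fPo [tuple u; v] = u.
Proof. by move=> ou ov; rewrite fcompX //; apply: fps_ord_tuple2. Qed.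

Lemma fcompY2 k (u v : {fps R[k]}) :
  fps_ord 1 u -> fps_ord 1 v -> Y2 \fPo [tuple u; v] = v.
Proof. by move=> ou ov; rewrite fcompX //; apply: fps_ord_tuple2. Qed.

Lemma fcompX3 k (u v w : {fps R[k]}) : fps_ord 1 u -> fps_ord 1 v ->
  fps_ord 1 w -> X3 \fPo [tuple u; v; w] = u.
Proof. by move=> ou ov ow; rewrite fcompX //; apply: fps_ord_tuple3. Qed.

Lemma fcompY3 k (u v w : {fps R[k]}) : fps_ord 1 u -> fps_ord 1 v ->
  fps_ord 1 w -> Y3 \fPo [tuple u; v; w] = v.
Proof. by move=> ou ov ow; rewrite fcompX //; apply: fps_ord_tuple3. Qed.

Lemma fcompZ3 k (u v w : {fps R[k]}) : fps_ord 1 u -> fps_ord 1 v ->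
  fps_ord 1 w -> Z3 \fPo [tuple u; v; w] = w.
Proof. by move=> ou ov ow; rewrite fcompX //; apply: fps_ord_tuple3. Qed.

Lemma fcomp2_id (f : {fps R[2]}) : f \fPo [tuple X2; Y2] = f.
Proof.
by apply: fcomp_id => [[[|[|//]] i]]; rewrite ?X2E ?Y2E;
   congr fpsX; apply: val_inj.
Qed.

Lemma fcomp0 n k (g : n.-tuple {fps R[k]}) : (0 : {fps R[n]}) \fPo g = 0.
Proof. exact: (fps_cont0 (fps_cont_fcomp g)). Qed.

Lemma ternary_coefD (F G : {fps {fps R[3]}[1]}) l :
  ternary_coef (F + G) l = ternary_coef F l + ternary_coef G l.
Proof. by []. Qed.

Lemma ternary_coefX (c : {fps R[3]}) k l :
  ternary_coef (fpsC 1 c * X1 ^+ k) l = if l == k then c else 0.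
Proof.
rewrite /ternary_coef X1E fps_monX fpsC_mulE /=.
have -> : ((U_(ord0) *+ l)%MM == (U_(ord0) *+ k)%MM :> 'X_{1..1}) = (l == k).
  apply/eqP/eqP => [|-> //] /(congr1 (@mdeg 1)).
  by rewrite !mdegMn mdeg1 !mul1n.
by case: ifP; rewrite ?mulr1 ?mulr0.
Qed.

End Variables.

Section FormalGroup.
Context (R : comPzRingType) (gr : grading R) (mu : fgl gr).

Lemma fgl_ord1 : fps_ord 1 mu.
Proof.
apply/fps_ord1; rewrite -(fcomp_0 mu [tuple X1; 0]) fgl_x0.
by apply: X1_ord1; rewrite mdeg0.
Qed.

Lemma fgl_coefx : mu U_(ord0)%MM = 1.
Proof.
have := congr1 (fun f : {fps R[1]} => f U_(ord0)%MM) (fgl_x0 mu).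
rewrite X1_coef fcomp_coef1 //; [|exact: fgl_ord1|].
  by rewrite !big_ord_recl big_ord0 X1_coef !mulr1 mulr0 !addr0.
by apply: fps_ord_tuple2 => //; apply: X1_ord1.
Qed.

Lemma fgl_coefy : mu U_(lift ord0 ord0)%MM = 1.
Proof.
have := congr1 (fun f : {fps R[1]} => f U_(ord0)%MM) (fgl_0y mu).
rewrite X1_coef fcomp_coef1 //; [|exact: fgl_ord1|].
  by rewrite !big_ord_recl big_ord0 [X in _ + (_ * X + _)]X1_coef
             !mulr1 mulr0 add0r addr0.
by apply: fps_ord_tuple2 => //; apply: X1_ord1.
Qed.

Local Notation iota := (formal_inverse mu).

(** The coefficient of [y] in [mu] is 1, so the implicit function theorem provides a witness for the
    choice in [formal_inverse]. *)
Lemma formal_inverseP : fps_ord 1 iota /\ mu \fPo [tuple X1; iota] = 0.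
Proof.
have [||u ou uE] := @fps_implicit R mu 1; first exact: fgl_ord1.
  by rewrite fgl_coefy mulr1.
rewrite /formal_inverse.
case: classical_sets.xgetP => [v -> [v0 vE]|/(_ u) []].
  by split => //; apply/fps_ord1.
by split => //; apply/fps_ord1.
Qed.

Lemma formal_inverse_ord1 : fps_ord 1 iota.
Proof. by have [] := formal_inverseP. Qed.

Context (k : nat).
Implicit Types u v w : {fps R[k]}.

(** On series without constant term these are the operations of an abelian group; its laws come from
    substituting into the axioms of [mu]. *)
Definition fadd u v := mu \fPo [tuple u; v].
Definition fneg u := iota \fPo [tuple u].

Lemma fadd_ord1 u v : fps_ord 1 (fadd u v).
Proof. exact/fcomp_ord1/fgl_ord1. Qed.

Lemma fneg_ord1 u : fps_ord 1 (fneg u).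
Proof. exact/fcomp_ord1/formal_inverse_ord1. Qed.

Lemma faddC u v : fps_ord 1 u -> fps_ord 1 v -> fadd u v = fadd v u.
Proof.
move=> ou ov; rewrite /fadd -[in LHS](fgl_comm mu).
rewrite fcompA2 ?fcompX2 ?fcompY2 //;
  by [apply: Y2_ord1|apply: X2_ord1|apply: fps_ord_tuple2].
Qed.

Lemma faddA u v w : fps_ord 1 u -> fps_ord 1 v -> fps_ord 1 w ->
  fadd (fadd u v) w = fadd u (fadd v w).
Proof.
move=> ou ov ow; have ot := fps_ord_tuple3 ou ov ow.
have oX := @X3_ord1 R; have oY := @Y3_ord1 R; have oZ := @Z3_ord1 R.
have := congr1 (fun f => f \fPo [tuple u; v; w]) (fgl_assoc mu).
rewrite !fcompA2 ?fcompX3 ?fcompY3 ?fcompZ3 //;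
  by apply/fcomp_ord1/fgl_ord1.
Qed.

Lemma fadd0 u : fps_ord 1 u -> fadd u 0 = u.
Proof.
move=> ou; have := congr1 (fun f => f \fPo [tuple u]) (fgl_x0 mu).
rewrite fcompA2 //; [|exact: X1_ord1|exact: fps_ord_tuple1].
by rewrite !fcompX1 // fcomp0.
Qed.

Lemma fadd0l u : fps_ord 1 u -> fadd 0 u = u.
Proof. by move=> ou; rewrite faddC ?fadd0. Qed.

Lemma faddN u : fps_ord 1 u -> fadd u (fneg u) = 0.
Proof.
move=> ou; have [oi iE] := formal_inverseP.
have := congr1 (fun f => f \fPo [tuple u]) iE.
rewrite fcompA2 //; [|exact: X1_ord1|exact: fps_ord_tuple1].
by rewrite !fcompX1 // fcomp0.
Qed.

Lemma fneg0 : fneg 0 = 0.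
Proof. by rewrite -[LHS]fadd0l ?faddN //; apply: fneg_ord1. Qed.

Lemma fnegK u : fps_ord 1 u -> fneg (fneg u) = u.
Proof.
move=> ou; have on := @fneg_ord1.
rewrite -[LHS]fadd0l // -(faddN ou) faddA // faddN // fadd0 //.
Qed.

End FormalGroup.

(** * Compatibility of the group operations with substitution, and their linear terms *)

Section Naturality.
Context (R : comPzRingType) (gr : grading R) (mu : fgl gr) (k l : nat).
Context (h : k.-tuple {fps R[l]}) (h_ord : forall i, fps_ord 1 (tnth h i)).

Lemma fadd_comp (u v : {fps R[k]}) : fps_ord 1 u -> fps_ord 1 v ->
  fadd mu u v \fPo h = fadd mu (u \fPo h) (v \fPo h).
Proof. by move=> ou ov; apply: fcompA2. Qed.

Lemma fneg_comp (u : {fps R[k]}) : fps_ord 1 u ->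
  fneg mu u \fPo h = fneg mu (u \fPo h).
Proof. by move=> ou; apply: fcompA1. Qed.

End Naturality.

Lemma fadd_coef1 (R : comPzRingType) (gr : grading R) (mu : fgl gr) k
    (u v : {fps R[k]}) j : fps_ord 1 u -> fps_ord 1 v ->
  fadd mu u v U_(j)%MM = u U_(j)%MM + v U_(j)%MM.
Proof.
move=> ou ov; rewrite fcomp_coef1; [|exact: fgl_ord1|exact: fps_ord_tuple2].
by rewrite !big_ord_recl big_ord0 fgl_coefx fgl_coefy !mul1r addr0.
Qed.

Lemma fneg_coef1 (R : comPzRingType) (gr : grading R) (mu : fgl gr) k
    (u : {fps R[k]}) j : fps_ord 1 u -> fneg mu u U_(j)%MM = - u U_(j)%MM.
Proof.
move=> ou; apply/eqP; rewrite -addr_eq0 addrC -(fadd_coef1 mu) ?faddN //.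
exact: fneg_ord1.
Qed.

(** Brings the product over sign triples that defines the ternary law into nested form, where it
    expands factor by factor. *)
Lemma prod_bool3 (S : comPzRingType) (P : pred (bool * bool * bool))
    (G : bool * bool * bool -> S) :
  \prod_(e | P e) G e =
  \prod_a \prod_b \prod_c if P (a, b, c) then G (a, b, c) else 1.
Proof.
rewrite big_mkcond /=; pose H e := if P e then G e else 1.
transitivity (\prod_p \prod_c H (p, c)).
  by rewrite (pair_bigA _ (fun p c => H (p, c))); apply: eq_bigr => -[].
rewrite [RHS](pair_bigA _ (fun a b => \prod_c H (a, b, c))).
by apply: eq_bigr => -[].
Qed.

(** * Reconstruction of the formal group law *)

Section Main.
Context (R : comPzRingType) (gr : grading R) (half : R).
Context (half_eq : 2 * half = 1).
Context (mu : fgl gr).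
Local Notation F := (ternary_coef (ternary_law (bbT half mu))).
Local Notation add := (fadd mu).
Local Notation neg := (fneg mu).

Let root_a : {fps R[2]} := add (add X2 X2) (neg Y2).
Let root_b : {fps R[2]} := add (add (neg X2) (neg X2)) (neg Y2).

Lemma fpsC_half n : fpsC n half * 2 = 1.
Proof.
have -> : 2 = fpsC n (2 : R) by rewrite (fpsCD n 1 1).
by rewrite -fpsCM mulrC half_eq.
Qed.

(** The coefficients are the elementary symmetric functions of the four roots. The roots enter as
    variables with equations, so that [ring] treats them as atoms. *)
Lemma bbT_coefE (e1 e2 e3 e4 : {fps R[3]})
    (e1E : e1 = add (add X3 Y3) (neg Z3)) (e2E : e2 = add (add X3 (neg Y3)) Z3)
    (e3E : e3 = add (add (neg X3) Y3) Z3)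
    (e4E : e4 = add (add (neg X3) (neg Y3)) (neg Z3)) :
  F 1 = e1 + e2 + e3 + e4 /\
  F 2 = e1 * e2 + e1 * e3 + e1 * e4 + e2 * e3 + e2 * e4 + e3 * e4.
Proof.
have -> : ternary_law (bbT half mu) =
  (1 + fpsC 1 e1 * X1) * (1 + fpsC 1 e2 * X1) *
  (1 + fpsC 1 e3 * X1) * (1 + fpsC 1 e4 * X1).
  rewrite /= prod_bool3 !big_bool /= e1E e2E e3E e4E /fadd /fneg.
  by ring.
have -> : (1 + fpsC 1 e1 * X1) * (1 + fpsC 1 e2 * X1) *
  (1 + fpsC 1 e3 * X1) * (1 + fpsC 1 e4 * X1) =
  fpsC 1 1 * X1 ^+ 0 + fpsC 1 (e1 + e2 + e3 + e4) * X1 ^+ 1 +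
  fpsC 1 (e1 * e2 + e1 * e3 + e1 * e4 + e2 * e3 + e2 * e4 + e3 * e4) * X1 ^+ 2 +
  fpsC 1 (e1 * e2 * e3 + e1 * e2 * e4 + e1 * e3 * e4 + e2 * e3 * e4) * X1 ^+ 3 +
  fpsC 1 (e1 * e2 * e3 * e4) * X1 ^+ 4.
  by rewrite !(fpsCD, fpsCM) -fps1E; ring.
by split; rewrite !ternary_coefD !ternary_coefX /= ?add0r ?addr0.
Qed.

Lemma diagonal_coefE :
  (F 1 \fPo [tuple X2; X2; Y2]) = 2 * Y2 + root_a + root_b /\
  (F 2 \fPo [tuple X2; X2; Y2]) =
    Y2 ^+ 2 + 2 * Y2 * (root_a + root_b) + root_a * root_b.
Proof.
have oX := @X2_ord1 R; have oY := @Y2_ord1 R.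
have oX3 := @X3_ord1 R; have oY3 := @Y3_ord1 R; have oZ3 := @Z3_ord1 R.
have ot := fps_ord_tuple3 oX oX oY.
have oa k (u v : {fps R[k]}) := @fadd_ord1 R gr mu k u v.
have on k (u : {fps R[k]}) := @fneg_ord1 R gr mu k u.
have [eX eY eZ] := And3 (fcompX3 oX oX oY) (fcompY3 oX oX oY) (fcompZ3 oX oX oY).
have [] := @bbT_coefE _ _ _ _ erefl erefl erefl erefl.
have : add (add X3 Y3) (neg Z3) \fPo [tuple X2; X2; Y2] = root_a.
  by rewrite !fadd_comp // fneg_comp // eX eY eZ.
have : add (add X3 (neg Y3)) Z3 \fPo [tuple X2; X2; Y2] = Y2.
  by rewrite !fadd_comp // fneg_comp // eX eY eZ faddN // fadd0l.
have : add (add (neg X3) Y3) Z3 \fPo [tuple X2; X2; Y2] = Y2.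
  rewrite !fadd_comp // fneg_comp // eX eY eZ.
  by rewrite [add (neg X2) _]faddC // faddN // fadd0l.
have : add (add (neg X3) (neg Y3)) (neg Z3) \fPo [tuple X2; X2; Y2] = root_b.
  by rewrite !fadd_comp // !fneg_comp // eX eY eZ.
(* From here on only the diagonal values of the roots matter, so the roots themselves become
   variables. *)
move: (add _ Z3) (add _ Z3) (add _ (neg Z3)) (add _ (neg Z3)).
move=> e1 e2 e3 e4 r1 r2 r3 r4 -> ->.
by rewrite !(fcompD, fcompM) // r1 r2 r3 r4; split; ring.
Qed.

Lemma bbG_SE : G_S (bbT half mu) = root_a + root_b.
Proof. by rewrite /G_S (proj1 diagonal_coefE); ring. Qed.

Lemma bbG_PE : G_P (bbT half mu) = root_a * root_b.
Proof. by rewrite /G_P bbG_SE (proj2 diagonal_coefE); ring. Qed.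

Lemma bbG_sqrtDE : G_sqrtD half (bbT half mu) = root_a - root_b.
Proof.
have oX := @X2_ord1 R; have oY := @Y2_ord1 R.
have oa k (u v : {fps R[k]}) := @fadd_ord1 R gr mu k u v.
have on k (u : {fps R[k]}) := @fneg_ord1 R gr mu k u.
set w := fps_divX ord0 1 (root_a - root_b).
(* At [x = 0] both roots become the formal inverse of [y], so their difference is divisible by
   [x]. *)
have wE : root_a - root_b = X2 * w.
  apply: fps_mul_divX; have oX1 := @X1_ord1 R.
  have ot := fps_ord_tuple2 (@fps_ord0 1 R 1) oX1.
  rewrite fcompB !fadd_comp // !fneg_comp // fcompX2 // fcompY2 //.
  by rewrite fneg0 subrr.
(* The constant term of [w] is the coefficient of [x] in [root_a - root_b], that is 2 - (-2). *)
have w0 : w 0%MM = 4.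
  have -> : w 0%MM = (root_a - root_b) (0 + U_(ord0) *+ 1)%MM by [].
  rewrite add0m mulm1n fpsBE !fadd_coef1 // !fneg_coef1 //.
  by rewrite X2E /= eqxx; ring.
(* [v] is [w / 4], normalised to constant term 1; its square is the argument of [fps_sqrt] in
   [G_sqrtD]. *)
pose v := fpsC 2 half ^+ 2 * w.
rewrite /G_sqrtD.
have -> : fpsC 2 half ^+ 4 * fps_divX ord0 2 (G_D (bbT half mu)) = v ^+ 2.
  have -> : G_D (bbT half mu) = fpsX R ord0 ^+ 2 * w ^+ 2.
    rewrite -X2E -exprMn -wE /G_D bbG_SE bbG_PE; ring.
  by rewrite fps_divXK /v; ring.
rewrite fps_sqrt_sqr //; last first.
  rewrite /v expr2 -mulrA !fpsC_mulE w0.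
  transitivity ((2 * half) ^+ 2); first by ring.
  by rewrite half_eq expr1n.
rewrite wE /v.
transitivity ((fpsC 2 half * 2) ^+ 2 * (X2 * w)); first by ring.
by rewrite fpsC_half expr1n mul1r.
Qed.

Lemma bbG_BE : G_B half (bbT half mu) = root_b.
Proof.
rewrite /G_B bbG_SE bbG_sqrtDE.
transitivity (fpsC 2 half * 2 * root_b); first by ring.
by rewrite fpsC_half mul1r.
Qed.

Lemma bbG_fE : G_f half (bbT half mu) = add (add X2 X2) Y2.
Proof.
have oX := @X2_ord1 R; have oY := @Y2_ord1 R.
have oa k (u v : {fps R[k]}) := @fadd_ord1 R gr mu k u v.
have on k (u : {fps R[k]}) := @fneg_ord1 R gr mu k u.
rewrite /G_f bbG_BE /= -/(neg X2) -/(neg Y2).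
have ot := fps_ord_tuple2 (on _ X2) (on _ Y2).
rewrite !fadd_comp // !fneg_comp // fcompX2 // fcompY2 //.
by rewrite !fnegK.
Qed.

Lemma bbG_doubleE : G_double half (bbT half mu) = add X1 X1.
Proof.
have oX := @X1_ord1 R; have oX2 := @X2_ord1 R; have oY2 := @Y2_ord1 R.
have oa k (u v : {fps R[k]}) := @fadd_ord1 R gr mu k u v.
have ot := fps_ord_tuple2 oX (@fps_ord0 1 R 1).
by rewrite /G_double bbG_fE !fadd_comp // fcompX2 // fcompY2 // fadd0.
Qed.

Lemma bbG_bbT : bbG half (bbT half mu) = mu.
Proof.
have oX2 := @X2_ord1 R; have oY2 := @Y2_ord1 R; have oX := @X1_ord1 R.
have oa k (u v : {fps R[k]}) := @fadd_ord1 R gr mu k u v.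
(* The linear coefficient of [add X1 X1] is 2, and [half] is its inverse. *)
have [||oh hE] := @compositional_inverseP R (add X1 X1) half.
- exact: oa.
- by rewrite fadd_coef1 // X1_coef.
rewrite /bbG /G_halve bbG_doubleE bbG_fE.
set h := compositional_inverse _ in oh hE *.
(* Doubling undoes halving, now in the variable [X2]; this collapses the first two summands of [G_f]
   after the substitution. *)
have hE2 : add (h \fPo [tuple X2]) (h \fPo [tuple X2]) = X2.
  have := congr1 (fun f => f \fPo [tuple @X2 R]) hE; rewrite /=.
  have o1 := fps_ord_tuple1 oh; have o2 := fps_ord_tuple1 oX2.
  by rewrite !fadd_comp // ?fcompX1 //; apply: fcomp_ord1.
have oh2 : fps_ord 1 (h \fPo [tuple @X2 R]) by apply: fcomp_ord1.
have ot := fps_ord_tuple2 oh2 oY2.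
rewrite !fadd_comp // fcompX2 // fcompY2 // hE2.
exact: fcomp2_id.
Qed.

End Main.

Theorem proposition8p4p7 (R : comPzRingType) (gr : grading R)
    (half : R) (half_eq : 2 * half = 1)
    (mu0 : fgl gr) (X : ternary_data R) (X_eq : X = bbT half mu0) :
  bbG half X = mu0.
Proof. by rewrite X_eq; apply: bbG_bbT. Qed.
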